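(* Let $p=2m$ and $q=2n$ with $m,n$ positive integers. The lengths of all linear curves in the Grassmann manifold $G^p_{p+q}$ are uniformly bounded: there is a constant $L$ (depending only on $p$ and $q$) such that every linear curve $V(t)$ in $G^p_{p+q}$ has length at most $L$ with respect to the Riemannian metric $g$.
   Context: $G^p_{p+q}$ is the Grassmann manifold of all $p$-dimensional subspaces of Euclidean space $\mathbb{R}^{p+q}$. It carries the Riemannian metric $g$ for which the quotient map $\Pi:O(p+q)\to O(p+q)/(O(p)\times O(q))=G^p_{p+q}$ is a Riemannian submersion, where $O(p+q)$ has the (bi-invariant) Lipschitz–Killing metric, normalized so that a tangent vector at the identity of the form $\begin{pmatrix}0&C\\-C^{T}&0\end{pmatrix}$ (blocks of sizes $p$ and $q$) has length $\left(\sum_{i,j}C_{ij}^2\right)^{1/2}$. A curve $V(t)$, $0\le t\le T$, in $G^p_{p+q}$ is called linear if there are vectors $e_i,d_i\in\mathbb{R}^{p+q}$, $i=1,\dots,p$, such that for every $t$ the $p$-dimensional subspace $V(t)$ is generated by the vectors $e_i(t)=e_i+t\,d_i$, $i=1,\dots,p$. Here $T>0$ is arbitrary. *)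

(* Defs.v *)
From HB Require Import structures.
From mathcomp Require Import all_boot all_order all_algebra.
From mathcomp Require Import all_classical all_reals all_analysis.
Set Implicit Arguments.
Unset Strict Implicit.
Unset Printing Implicit Defensive.
Import Order.TTheory GRing.Theory Num.Theory.
Import numFieldNormedType.Exports.
Local Open Scope classical_set_scope.
Local Open Scope ring_scope.

Record grassmann (R : realType) (p q : nat) := Grassmann {
  gr_space :> {vspace 'cV[R]_(p + q)};
  gr_dim : \dim gr_space = p }.

Definition orthogonal_mx (R : realType) (n : nat) (Q : 'M[R]_n) : Prop :=
  Q^T *m Q = 1%:M.

(* The quotient map Pi : O(p+q) -> O(p+q)/(O(p) x O(q)), where the coset of Q
   is identified with the image under Q of the base point R^p x 0. *)
Definition gr_proj (R : realType) (p q : nat) (Q : 'M[R]_(p + q)) :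
    {vspace 'cV[R]_(p + q)} :=
  <<[seq col (lshift q i) Q | i : 'I_p]>>%VS.

(* The bi-invariant metric of O(n). For X = Q A and Y = Q B tangent at an
   orthogonal Q (A, B skew) it equals tr(A^T B) / 2 = - tr(A B) / 2,
   independently of Q; for A = block_mx 0 C (- C^T) 0, the squared length is
   the sum of the C i j ^+ 2. *)
Definition lk_metric (R : realType) (n : nat) (X Y : 'M[R]_n) : R :=
  2^-1 * \tr (X^T *m Y).

Definition lk_norm (R : realType) (n : nat) (X : 'M[R]_n) : R :=
  Num.sqrt (lk_metric X X).

(* The tangent space at Q of the fibre Q (O(p) x O(q)) of gr_proj. *)
Definition vertical (R : realType) (p q : nat) (Q Y : 'M[R]_(p + q)) : Prop :=
  exists (a : 'M[R]_p) (b : 'M[R]_q),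
    [/\ a^T = - a, b^T = - b & Y = Q *m block_mx a 0 0 b].

Definition horizontal (R : realType) (p q : nat) (Q X : 'M[R]_(p + q)) : Prop :=
  forall Y, vertical Q Y -> lk_metric X Y = 0.

(* X is the horizontal lift of the velocity of V at time t: the derivative at t
   of a curve of orthogonal matrices lying over V near t, when this derivative
   is horizontal. *)
Definition horizontal_velocity (R : realType) (p q : nat)
    (V : R -> grassmann R p q) (t : R) (X : 'M[R]_(p + q)) : Prop :=
  exists Q : R -> 'M[R]_(p + q),
    [/\ \forall s \near t, orthogonal_mx (Q s) /\ gr_proj (Q s) = V s,
        is_derive t 1 Q X
      & horizontal (Q t) X].

(* The norm of V'(t) in the metric g making gr_proj a Riemannian submersion,
   i.e. isometric on horizontal vectors. All horizontal lifts of V'(t) have the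
   same norm, so the infimum only selects that value; it is +oo if V has no
   lift differentiable at t. *)
Definition gr_speed (R : realType) (p q : nat)
    (V : R -> grassmann R p q) (t : R) : \bar R :=
  ereal_inf [set (lk_norm X)%:E | X in horizontal_velocity V t].

(* The length of the restriction of V to [0, T]. The endpoints are omitted
   because the speed there would involve V outside [0, T]; they are negligible
   for the integral. *)
Definition gr_length (R : realType) (p q : nat)
    (T : R) (V : R -> grassmann R p q) : \bar R :=
  (\int[lebesgue_measure]_(t in `]0%R, T[) gr_speed V t)%E.

Definition linear_curve (R : realType) (p q : nat)
    (T : R) (V : R -> grassmann R p q) : Prop :=
  exists e d : 'I_p -> 'cV[R]_(p + q),
    forall t : R, 0 <= t <= T ->
      gr_space (V t) = <<[seq (e i + t *: d i)%R | i : 'I_p]>>%VS.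

(* Main.v *)
Require Import Defs.
From mathcomp Require Import all_boot all_order all_algebra.
From mathcomp Require Import all_classical all_reals all_analysis.
From mathcomp Require Import measurable_realfun perm complex ring lra.

(** Let A(t) be the matrix with columns e_i + t d_i. Its maximal minors are
    polynomials of degree at most p in t, so in Pluecker coordinates a linear
    curve is a rational curve of degree at most p, and a rational curve in
    projective space has bounded length: for two of its coordinates P and Q,
    the angle of the plane curve (P, Q) has speed
    |P Q' - Q P'| / (P^2 + Q^2), which is the absolute value of the imaginary
    part of the logarithmic derivative of P + iQ, hence at most the sum of the
    Cauchy kernels |b| / ((t - a)^2 + b^2) over the roots a + ib of P + iQ
    ([angular_speed_le]). Each kernel has integral at most pi over any interval
    ([integral_cauchy_kernel_le]), and there are at most p roots, whatever the
    curve.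

    The speed of the curve of subspaces is bounded by these angular speeds in
    an elementary way, without exterior powers. At a given time choose rows f
    for which the minor of A is largest in absolute value, and normalize the
    frame to B = A A_f^-1, where A_f is the submatrix of the rows f. By
    Cramer's rule the entries of B are quotients Q / P of minors of A with
    |Q| <= |P|, so that the derivative of each entry is at most twice an
    angular speed ([gr_speed_le_minors]).

    It remains to see that the speed is at most p times the sum of the absolute
    values of the entries of B' ([gr_speed_le_frame]), and this needs an
    explicit horizontal lift. Replace B(s) by a frame of the same space whose
    derivative at t is orthogonal to the space; its Gram matrix is then
    stationary at t, and so is the Cholesky factor that orthonormalizes it
    ([is_derive_orthonormalize]). A constant basis of the orthogonal complement
    at time t, projected and orthonormalized in the same way, completes this to
    a curve of orthogonal matrices ([horizontal_lift_exists]). *)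

Import Order.TTheory GRing.Theory Num.Theory.
Import numFieldNormedType.Exports.
Set Implicit Arguments.
Unset Strict Implicit.
Unset Printing Implicit Defensive.
Local Open Scope ring_scope.

(** * Angular speed of a plane polynomial curve *)

Lemma horner_logderiv_prod_XsubC (F : fieldType) (s : seq F) (x : F) :
  (\prod_(z <- s) ('X - z%:P)).[x] != 0 ->
  (\prod_(z <- s) ('X - z%:P))^`().[x] / (\prod_(z <- s) ('X - z%:P)).[x] =
  \sum_(z <- s) (x - z)^-1.
Proof.
elim: s => [|z s IHs]; first by rewrite !big_nil derivC horner0 mul0r.
rewrite !big_cons hornerM mulf_eq0 negb_or => /andP[xz0 s0].
rewrite -IHs // derivM hornerD !hornerM.
rewrite derivXsubC hornerC hornerXsubC in xz0 *.
by field; rewrite xz0 s0.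
Qed.

(** The absolute value of the imaginary part of 1 / (t - z), for the complex
    number z = z.1 + i z.2. It vanishes identically for real z, because the
    division by zero at t = z.1 has numerator zero. *)
Definition cauchy_kernel (R : realType) (z : R * R) (t : R) : R :=
  `|z.2| / ((t - z.1) ^+ 2 + z.2 ^+ 2).

(** The quotient is the absolute value of the imaginary part of f' / f for
    f = P + iQ, and f' / f is the sum of the 1 / (t - z) over the complex
    roots z of f. *)
Lemma angular_speed_le (R : realType) (d : nat) (P Q : {poly R}) :
  (size P <= d.+1)%N -> (size Q <= d.+1)%N ->
  exists s : seq (R * R), (size s <= d)%N /\
    forall t, P.[t] ^+ 2 + Q.[t] ^+ 2 != 0 ->
    `|P.[t] * Q^`().[t] - Q.[t] * P^`().[t]| / (P.[t] ^+ 2 + Q.[t] ^+ 2)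
      <= \sum_(z <- s) cauchy_kernel z t.
Proof.
move=> sP sQ.
pose C := complex R.
pose toC := @real_complex_def R (Phant R).
pose f : {poly C} := map_poly toC P + (Complex 0 1)%:P * map_poly toC Q.
have fE (P1 Q1 : {poly R}) t :
    (map_poly toC P1 + (Complex 0 1)%:P * map_poly toC Q1).[toC t] =
    Complex P1.[t] Q1.[t].
  rewrite hornerD hornerM hornerC !horner_map /= /toC.
  by apply/eqP; rewrite eq_complex /= !(mul0r, mul1r, addr0, subr0, add0r) !eqxx.
have f'E t : f^`().[toC t] = Complex P^`().[t] Q^`().[t].
  by rewrite -fE derivD derivM derivC mul0r add0r !deriv_map.
have [r fr] := closed_field_poly_normal f.
have [f0|f0] := eqVneq f 0.
  exists [::]; split=> // t; have := fE P Q t.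
  by rewrite -/f f0 horner0 => -[<- <-]; rewrite expr0n addr0 eqxx.
exists [seq (complex.Re z, complex.Im z) | z <- r]; rewrite size_map; split.
  have : (size f <= d.+1)%N.
    rewrite (leq_trans (size_polyD _ _))// geq_max mul_polyC.
    by rewrite size_map_poly sP (leq_trans (size_scale_leq _ _))// size_map_poly.
  by rewrite fr size_scale ?lead_coef_eq0// size_prod_XsubC.
move=> t PQ0; rewrite big_map /=.
have ft0 : f.[toC t] != 0.
  rewrite fE eq_complex /=; apply: contra PQ0 => /andP[/eqP -> /eqP ->].
  by rewrite expr0n addr0.
have ld : f^`().[toC t] / f.[toC t] = \sum_(z <- r) (toC t - z)^-1.
  move: ft0; rewrite fr derivZ !hornerZ mulf_eq0 negb_or => /andP[c0 p0].
  by rewrite invfM mulrACA divff// mul1r horner_logderiv_prod_XsubC.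
(* Complex conjugation of the denominator: (P' + iQ') / (P + iQ) has imaginary
   part (P Q' - Q P') / (P^2 + Q^2). *)
have -> : (P.[t] * Q^`().[t] - Q.[t] * P^`().[t]) =
    complex.Im (f^`().[toC t] / f.[toC t]) * (P.[t] ^+ 2 + Q.[t] ^+ 2).
  by rewrite f'E fE /=; field.
have n0 : 0 < P.[t] ^+ 2 + Q.[t] ^+ 2 by rewrite lt0r PQ0 addr_ge0 ?sqr_ge0.
rewrite normrM (gtr0_norm n0) mulfK// ld.
elim/big_ind2 : _ => [|x1 x2 y1 y2 H1 H2|[a b] _]; first by rewrite normr0.
  rewrite raddfD; apply: le_trans (ler_normD _ _) (lerD H1 H2).
rewrite /= sub0r sqrrN mulNr opprK normrM [`|_^-1|]ger0_norm//.
by rewrite invr_ge0 addr_ge0 ?sqr_ge0.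
Qed.

(** * Integrals of Cauchy kernels *)

(** The integral of a nonnegative function is defined as a supremum over the
    simple functions below it, which is monotone without any measurability; the
    speed of a curve of subspaces is an infimum that is not known to be
    measurable. *)
Lemma ge0_integral_le_unmeasurable d (X : measurableType d) (R : realType)
    (mu : {measure set X -> \bar R}) (D : set X) (f g : X -> \bar R) :
  (forall x, D x -> (0 <= f x)%E) -> (forall x, D x -> (f x <= g x)%E) ->
  (\int[mu]_(x in D) f x <= \int[mu]_(x in D) g x)%E.
Proof.
move=> f0 fg.
have g0 x : D x -> (0 <= g x)%E by move=> Dx; exact: le_trans (f0 x Dx) (fg x Dx).
rewrite !ge0_integralE//; apply: ereal_sup_le => _ [h hf <-]; exists h => // x.
by apply: le_trans (hf x) _; exact: lee_restrict.
Qed.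

Lemma cauchy_kernel_ge0 (R : realType) (z : R * R) (t : R) :
  0 <= cauchy_kernel z t.
Proof. by rewrite divr_ge0// addr_ge0 ?sqr_ge0. Qed.

Lemma cauchy_kernel_derive (R : realType) (a b x : R) : b != 0 ->
  is_derive x 1 (fun t => atan ((t - a) / `|b|)) (cauchy_kernel (a, b) x).
Proof.
move=> b0.
have h : is_derive x 1 (fun t : R => (t - a) / `|b|) `|b|^-1.
  rewrite -[X in is_derive _ _ X _]/((fun t => (t - a) * cst `|b|^-1 t)).
  by apply: is_derive_eq; rewrite scaler0 add0r subr0 /GRing.scale /= mulr1.
apply: (is_derive_eq (is_derive1_comp _ h)).
rewrite /cauchy_kernel /= /GRing.scale /=.
rewrite -[in RHS](real_normK (num_real b)).
have b1 : 0 < `|b| by rewrite normr_gt0.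
have h1 : 1 + ((x - a) / `|b|) ^+ 2 != 0 by rewrite gt_eqF// ltr_pwDl// sqr_ge0.
have h2 : (x - a) ^+ 2 + `|b| ^+ 2 != 0.
  by rewrite gt_eqF// ltr_wpDl ?sqr_ge0// exprn_gt0.
by field; rewrite h2 gt_eqF//= addrC.
Qed.

Lemma cauchy_kernel_continuous (R : realType) (z : R * R) :
  continuous (cauchy_kernel z).
Proof.
case: z => a b x; have [->|b0] := eqVneq b 0.
  have -> : cauchy_kernel (a, 0) = cst 0.
    by apply/funext => t; rewrite /cauchy_kernel/= normr0 mul0r.
  exact: cvg_cst.
rewrite /cauchy_kernel /=; apply: cvgM; first exact: cvg_cst.
apply: cvgV; first by rewrite gt_eqF// ltr_wpDl ?sqr_ge0// exprn_even_gt0.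
apply: cvgD; last exact: cvg_cst.
by apply: cvgM; (apply: cvgB; [exact: cvg_id|exact: cvg_cst]).
Qed.

(** For b != 0 the antiderivative atan ((t - a) / |b|) takes its values in an
    open interval of length pi. *)
Lemma integral_cauchy_kernel_le (R : realType) (T : R) (z : R * R) : 0 < T ->
  (\int[lebesgue_measure]_(t in `]0%R, T[) (cauchy_kernel z t)%:E <= (pi : R)%:E)%E.
Proof.
case: z => a b T0.
have [->|b0] := eqVneq b 0.
  rewrite integral0_eq ?lee_fin ?pi_ge0// => t _.
  by rewrite /cauchy_kernel/= normr0 mul0r.
apply: (@le_trans _ _
  (\int[lebesgue_measure]_(t in `[0%R, T]) (cauchy_kernel (a, b) t)%:E)%E).
  apply: ge0_subset_integral => //; last exact: subset_itv_oo_cc.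
    apply/measurable_EFinP; apply: measurable_funTS.
    by apply: continuous_measurable_fun; exact: cauchy_kernel_continuous.
  by move=> t _; rewrite lee_fin cauchy_kernel_ge0.
have dF x := cauchy_kernel_derive a x b0.
rewrite (@continuous_FTC2 _ _ (fun t => atan ((t - a) / `|b|))) //.
- rewrite -EFinB lee_fin.
  have := atan_ltpi2 ((T - a) / `|b|); have := atan_gtNpi2 ((0 - a) / `|b|).
  set u := atan _; set v := atan _; move=> h1 h2.
  rewrite (_ : pi = pi / 2 + pi / 2 :> R); last by rewrite -splitr.
  by move: h1 h2; set w := pi / 2; lra.
- by apply: continuous_subspaceT; exact: cauchy_kernel_continuous.
- have cF x : {for x, continuous (fun t => atan ((t - a) / `|b|))}.
    by apply/differentiable_continuous/derivable1_diffP; exact: ex_derive.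
  split.
  + by move=> x _; exact: ex_derive.
  + by apply: cvg_at_right_filter; exact: cF.
  + by apply: cvg_at_left_filter; exact: cF.
- by move=> x _; rewrite derive1E; apply: derive_val.
Qed.

Lemma integral_le_cauchy_kernels (R : realType) (T c : R) (s : seq (R * R))
    (f : R -> \bar R) :
  0 < T -> 0 <= c -> (forall t, (0 <= f t)%E) ->
  (forall t, 0 < t < T -> (f t <= (c * \sum_(z <- s) cauchy_kernel z t)%:E)%E) ->
  (\int[lebesgue_measure]_(t in `]0%R, T[) f t <= (c * (size s)%:R * pi)%:E)%E.
Proof.
move=> T0 c0 f0 fle.
have mk z : measurable_fun `]0%R, T[%classic (EFin \o cauchy_kernel z).
  apply/measurable_EFinP; apply: measurable_funTS.
  by apply: continuous_measurable_fun; exact: cauchy_kernel_continuous.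
apply: (@le_trans _ _ (\int[lebesgue_measure]_(t in `]0%R, T[)
    (c%:E * \sum_(z <- s) (cauchy_kernel z t)%:E))%E).
  apply: ge0_integral_le_unmeasurable => // t /=; rewrite in_itv /= => /fle.
  by rewrite sumEFin -EFinM.
rewrite ge0_integralZl_EFin//; last 2 first.
- by move=> t _; rewrite sume_ge0// => z _; rewrite lee_fin cauchy_kernel_ge0.
- exact: emeasurable_sum.
rewrite ge0_integral_sum//; last by move=> *; rewrite lee_fin cauchy_kernel_ge0.
rewrite -mulrA EFinM; apply: lee_wpmul2l; first by rewrite lee_fin.
have -> : (size s)%:R * pi = \sum_(z <- s) pi :> R.
  by rewrite big_const_seq count_predT iter_addr addr0 mulr_natl.
rewrite -sumEFin; apply: lee_sum => z _.
exact: integral_cauchy_kernel_le.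
Qed.

(** * Derivatives of matrices and Cholesky factors *)

Lemma is_derive_mxP (R : realType) (m n : nat) (F : R -> 'M[R]_(m, n)) (t : R)
    (X : 'M[R]_(m, n)) :
  (forall i j, is_derive t 1 (fun s => F s i j) (X i j)) <-> is_derive t 1 F X.
Proof.
split=> [dF|[dF <-] i j].
  have dF1 : derivable F t 1 by apply/derivable_mxP => i j; exact: ex_derive.
  by split=> //; rewrite derive_mx//; apply/matrixP => i j; rewrite mxE derive_val.
rewrite derive_mx// mxE; apply: derivableP.
by move/derivable_mxP : dF; exact.
Qed.

Lemma is_derive_mulmx (R : realType) (m n p : nat) (F : R -> 'M[R]_(m, n))
    (G : R -> 'M[R]_(n, p)) (t : R) (X : 'M[R]_(m, n)) (Y : 'M[R]_(n, p)) :
  is_derive t 1 F X -> is_derive t 1 G Y ->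
  is_derive t 1 (fun s => F s *m G s) (X *m G t + F t *m Y).
Proof.
move=> /is_derive_mxP dF /is_derive_mxP dG; apply/is_derive_mxP => i j.
rewrite (_ : (fun s => _) = \sum_k ((fun s => F s i k) * (fun s => G s k j))).
  rewrite !mxE -big_split /=; apply: is_derive_eq.
  by apply: eq_bigr => k _; rewrite /GRing.scale /=; ring.
by apply/funext => s; rewrite mxE fct_sumE.
Qed.

Lemma is_derive_trmx (R : realType) (m n : nat) (F : R -> 'M[R]_(m, n)) (t : R)
    (X : 'M[R]_(m, n)) :
  is_derive t 1 F X -> is_derive t 1 (fun s => (F s)^T) X^T.
Proof.
move=> /is_derive_mxP dF; apply/is_derive_mxP => i j.
by rewrite mxE (_ : (fun s => _) = (fun s => F s j i))//; apply/funext => s; rewrite mxE.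
Qed.

Lemma is_derive_scalemx (R : realType) (m n : nat) (f : R -> R)
    (F : R -> 'M[R]_(m, n)) (t x : R) (X : 'M[R]_(m, n)) :
  is_derive t 1 f x -> is_derive t 1 F X ->
  is_derive t 1 (fun s => f s *: F s) (x *: F t + f t *: X).
Proof.
move=> df /is_derive_mxP dF; apply/is_derive_mxP => i j.
rewrite (_ : (fun s => _) = f * (fun s => F s i j)).
  by rewrite !mxE; apply: is_derive_eq; rewrite /GRing.scale /=; ring.
by apply/funext => s; rewrite mxE.
Qed.

Lemma is_derive_row_mx (R : realType) (m n1 n2 : nat) (F : R -> 'M[R]_(m, n1))
    (G : R -> 'M[R]_(m, n2)) (t : R) (X : 'M[R]_(m, n1)) (Y : 'M[R]_(m, n2)) :
  is_derive t 1 F X -> is_derive t 1 G Y ->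
  is_derive t 1 (fun s => row_mx (F s) (G s)) (row_mx X Y).
Proof.
move=> /is_derive_mxP dF /is_derive_mxP dG; apply/is_derive_mxP => i j.
rewrite mxE (_ : (fun s => _) = (fun s => match fintype.split j with
   inl j1 => F s i j1 | inr j2 => G s i j2 end)).
  by case: (fintype.split j).
by apply/funext => s; rewrite mxE.
Qed.

Lemma is_derive_col_mx (R : realType) (m1 m2 n : nat) (F : R -> 'M[R]_(m1, n))
    (G : R -> 'M[R]_(m2, n)) (t : R) (X : 'M[R]_(m1, n)) (Y : 'M[R]_(m2, n)) :
  is_derive t 1 F X -> is_derive t 1 G Y ->
  is_derive t 1 (fun s => col_mx (F s) (G s)) (col_mx X Y).
Proof.
move=> /is_derive_mxP dF /is_derive_mxP dG; apply/is_derive_mxP => i j.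
rewrite mxE (_ : (fun s => _) = (fun s => match fintype.split i with
   inl i1 => F s i1 j | inr i2 => G s i2 j end)).
  by case: (fintype.split i).
by apply/funext => s; rewrite mxE.
Qed.

(** Symmetry is included, so that a positive definite matrix has a Cholesky
    factorization. *)
Definition posdef_mx (R : realType) (n : nat) (G : 'M[R]_n) : Prop :=
  G^T = G /\ forall x : 'cV[R]_n, x != 0 -> 0 < (x^T *m G *m x) 0 0.

Definition schur (R : realType) (n : nat) (G : 'M[R]_(1 + n)) : 'M[R]_n :=
  drsubmx G - (ulsubmx G 0 0)^-1 *: ((ursubmx G)^T *m ursubmx G).

(** The inverse C of the upper triangular Cholesky factor of G, so that
    C^T G C = 1. Eliminating the first coordinate leaves the Schur complement,
    whence the recursion. The explicit formula, with square roots of scalars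
    only, is what makes the differentiability of C in G easy. *)
Fixpoint inv_chol (R : realType) (n : nat) : 'M[R]_n -> 'M[R]_n :=
  match n with
  | 0 => fun=> 1%:M
  | k.+1 => fun G : 'M[R]_(1 + k) =>
      let a := ulsubmx G 0 0 in
      let C := inv_chol (schur G) in
      block_mx ((Num.sqrt a)^-1)%:M (- a^-1 *: (ursubmx G *m C)) 0 C
  end.

Lemma sym_block1 (R : realType) (n : nat) (G : 'M[R]_(1 + n)) : G^T = G ->
  G = block_mx (ulsubmx G 0 0)%:M (ursubmx G) (ursubmx G)^T (drsubmx G).
Proof.
move=> Gs; rewrite -mx11_scalar; rewrite trmx_ursub Gs.
by rewrite submxK.
Qed.

Lemma posdef_pivot (R : realType) (n : nat) (G : 'M[R]_(1 + n)) :
  posdef_mx G -> 0 < ulsubmx G 0 0.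
Proof.
move=> [Gs Gp]; have := Gp (col_mx 1%:M 0).
rewrite {1}(sym_block1 Gs) tr_col_mx mul_row_block mul_row_col.
rewrite !(trmx0, trmx1, mul0mx, mulmx0, addr0, mul1mx, mulmx1) mxE eqxx mulr1n.
apply; apply/eqP => /(congr1 usubmx); rewrite col_mxKu => /matrixP/(_ 0 0).
by rewrite !mxE eqxx => /eqP; rewrite oner_eq0.
Qed.

(** The value of the Schur complement at y is the value of G at the vector with
    lower part y whose first coordinate minimizes it. *)
Lemma posdef_schur (R : realType) (n : nat) (G : 'M[R]_(1 + n)) :
  posdef_mx G -> posdef_mx (schur G).
Proof.
move=> pG; have a0 := posdef_pivot pG; have [Gs Gp] := pG; split.
  rewrite /schur linearB linearZ /= trmx_mul trmxK -{1}Gs.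
  by rewrite trmx_drsub trmxK.
move=> y y0; have := Gp (col_mx (- (ulsubmx G 0 0)^-1 *: (ursubmx G *m y)) y).
rewrite -mulmxA.
have -> : G *m col_mx (- (ulsubmx G 0 0)^-1 *: (ursubmx G *m y)) y =
    col_mx 0 (schur G *m y).
  rewrite {1}(sym_block1 Gs) mul_block_col mul_scalar_mx scalerA mulrN divff ?gt_eqF//.
  rewrite scaleN1r addNr /schur mulmxBl -scalemxAr -scalemxAl mulmxA scaleNr addrC//.
rewrite tr_col_mx mul_row_col mulmx0 add0r mulmxA; apply.
by apply: contra y0 => /eqP/(congr1 dsubmx); rewrite col_mxKd linear0 => ->.
Qed.

Lemma inv_cholS (R : realType) (n : nat) (G : 'M[R]_(1 + n)) :
  inv_chol G = block_mx ((Num.sqrt (ulsubmx G 0 0))^-1)%:M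
    (- (ulsubmx G 0 0)^-1 *: (ursubmx G *m inv_chol (schur G))) 0 (inv_chol (schur G))
  :> 'M[R]_(1 + n).
Proof. by []. Qed.

Lemma inv_cholP (R : realType) (n : nat) (G : 'M[R]_n) :
  posdef_mx G -> (inv_chol G)^T *m G *m inv_chol G = 1%:M.
Proof.
elim: n G => [|n IHn]; first by move=> G _; apply/matrixP => -[].
suff step (G : 'M[R]_(1 + n)) : posdef_mx G ->
    (inv_chol G)^T *m G *m inv_chol G = 1%:M :> 'M[R]_(1 + n) by exact: step.
move=> pG; have a0 := posdef_pivot pG; have [Gs _] := pG.
have := IHn _ (posdef_schur pG); rewrite inv_cholS.
move: a0; rewrite /schur; set a := ulsubmx G 0 0 => a0; set v := ursubmx G.
set D := drsubmx G; set C := inv_chol _ => CD.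
rewrite (sym_block1 Gs) -/a -/v -/D.
rewrite -mulmxA mulmx_block tr_block_mx mulmx_block.
rewrite !(trmx0, mulmx0, mul0mx, addr0, add0r, tr_scalar_mx) -!scalar_mxM.
rewrite !mul_scalar_mx !mul_mx_scalar !linearZ /= !scalerA.
have -> : - a^-1 * a = -1 by rewrite mulNr mulVf ?gt_eqF.
rewrite scaleN1r addNr scaler0 mulmx0 add0r.
have sa : Num.sqrt a * Num.sqrt a = a by rewrite -expr2 sqr_sqrtr// ltW.
have sa0 : Num.sqrt a != 0 by rewrite gt_eqF// sqrtr_gt0.
have -> : a / Num.sqrt a = Num.sqrt a by rewrite -{1}sa mulfK.
rewrite mulVf// -trmx_mul -scalerDl.
have -> : - a^-1 * Num.sqrt a + (Num.sqrt a)^-1 = 0.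
  by rewrite -{1}sa invfM mulNr mulfVK// addNr.
have -> : C^T *m (- a^-1 *: (v^T *m (v *m C)) + D *m C) = 1%:M.
  by rewrite -CD -mulmxA; congr (_ *m _); rewrite mulmxBl scaleNr addrC -scalemxAl mulmxA.
by rewrite scale0r -scalar_mx_block.
Qed.

Lemma is_derive_entry (R : realType) (m n m' n' : nat) (F : R -> 'M[R]_(m, n))
    (H : R -> 'M[R]_(m', n')) (t : R) (f : 'I_m' -> 'I_m) (g : 'I_n' -> 'I_n)
    (X : 'M[R]_(m, n)) :
  (forall s, H s = mxsub f g (F s)) ->
  is_derive t 1 F X -> is_derive t 1 H (mxsub f g X).
Proof.
move=> HF /is_derive_mxP dF; apply/is_derive_mxP => i j; rewrite mxE.
rewrite (_ : (fun s => _) = (fun s => F s (f i) (g j)))//.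
by apply/funext => s; rewrite HF mxE.
Qed.

Lemma is_derive_inv (R : realType) (f : R -> R) (t d : R) :
  f t != 0 -> is_derive t 1 f d ->
  is_derive t 1 (fun s => (f s)^-1) (- (f t) ^- 2 * d).
Proof. by move=> f0 [df <-]; split; [exact: derivableV|rewrite deriveV]. Qed.

(** Where G is stationary, so are all pivots and Schur complements; the pivots
    are positive, so that their square roots and inverses are stationary too. *)
Lemma is_derive_inv_chol0 (R : realType) (n : nat) (G : R -> 'M[R]_n) (t : R) :
  posdef_mx (G t) -> is_derive t 1 G 0 -> is_derive t 1 (fun s => inv_chol (G s)) 0.
Proof.
elim: n G => [|n IHn]; first by move=> G _ _; apply/is_derive_mxP => -[].
suff step (G : R -> 'M[R]_(1 + n)) : posdef_mx (G t) -> is_derive t 1 G 0 ->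
    is_derive t 1 (fun s => inv_chol (G s) : 'M[R]_(1 + n)) 0 by move=> G; exact: step.
move=> pG dG; have a0 := posdef_pivot pG.
have d0 m' n' (f : 'I_m' -> 'I_(1 + n)) (g : 'I_n' -> 'I_(1 + n)) H :
    (forall s, H s = mxsub f g (G s)) -> is_derive t 1 H 0.
  move=> HG; have := is_derive_entry HG dG; rewrite (_ : mxsub _ _ _ = 0)//.
  by apply/matrixP => i j; rewrite !mxE.
have da : is_derive t 1 (fun s => ulsubmx (G s) 0 0) 0.
  have /is_derive_mxP/(_ 0 0) : is_derive t 1 (fun s => ulsubmx (G s)) 0.
    by apply: d0 => s; apply/matrixP => i j; rewrite !mxE.
  by rewrite mxE.
have dv : is_derive t 1 (fun s => ursubmx (G s)) 0.
  by apply: d0 => s; apply/matrixP => i j; rewrite !mxE.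
have dD : is_derive t 1 (fun s => drsubmx (G s)) 0.
  by apply: d0 => s; apply/matrixP => i j; rewrite !mxE.
have dai : is_derive t 1 (fun s => (ulsubmx (G s) 0 0)^-1) 0.
  by apply: is_derive_eq (is_derive_inv _ da) _; rewrite ?gt_eqF// mulr0.
have dsai : is_derive t 1 (fun s => (Num.sqrt (ulsubmx (G s) 0 0))^-1) 0.
  have ds := @is_derive1_comp _ _ _ _ _ _ (is_derive1_sqrt a0) da.
  apply: is_derive_eq (is_derive_inv _ ds) _; first by rewrite gt_eqF ?sqrtr_gt0.
  by rewrite ?(scaler0, mulr0, mul0r).
have dS : is_derive t 1 (fun s => schur (G s)) 0.
  have dvv := is_derive_scalemx dai (is_derive_mulmx (is_derive_trmx dv) dv).
  apply: is_derive_eq (is_deriveB dD dvv) _.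
  by rewrite trmx0 mul0mx mulmx0 addr0 !scaler0 scale0r addr0 subr0.
have dC := IHn _ (posdef_schur pG) dS.
have dur := is_derive_scalemx (is_deriveN dai) (is_derive_mulmx dv dC).
have dul : is_derive t 1
    (fun s => ((Num.sqrt (ulsubmx (G s) 0 0))^-1)%:M : 'M[R]_1) 0.
  have := is_derive_scalemx dsai (is_derive_cst (1%:M : 'M[R]_1) t 1).
  rewrite scale0r scaler0 addr0.
  rewrite (_ : (fun s => _) = (fun s => ((Num.sqrt (ulsubmx (G s) 0 0))^-1)%:M))//.
  by apply/funext => s; rewrite scalemx1.
have := is_derive_col_mx (is_derive_row_mx dul dur)
  (is_derive_row_mx (is_derive_cst (0 : 'M[R]_(n, 1)) t 1) dC).
rewrite (_ : (fun s => col_mx _ _) = (fun s => inv_chol (G s))); last first.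
  by apply/funext => s; rewrite inv_cholS.
rewrite oppr0 scale0r mul0mx mulmx0 addr0 scaler0 addr0 !row_mx0 col_mx0.
exact.
Qed.

Lemma mxtrace_gram (R : realType) (m n : nat) (M : 'M[R]_(m, n)) :
  \tr (M^T *m M) = \sum_j \sum_i M i j ^+ 2.
Proof.
by apply: eq_bigr => j _; rewrite mxE; apply: eq_bigr => i _; rewrite mxE expr2.
Qed.

Lemma mxtrace_gram_ge0 (R : realType) (m n : nat) (M : 'M[R]_(m, n)) :
  0 <= \tr (M^T *m M).
Proof. by rewrite mxtrace_gram; do 2 (apply: sumr_ge0 => ? _); exact: sqr_ge0. Qed.

Lemma sqrt_mxtrace_gram_le (R : realType) (m n : nat) (M : 'M[R]_(m, n)) :
  Num.sqrt (\tr (M^T *m M)) <= \sum_i \sum_j `|M i j|.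
Proof.
have S0 : 0 <= \sum_i \sum_j `|M i j|.
  by do 2 (apply: sumr_ge0 => ? _); exact: normr_ge0.
rewrite -[leRHS]ger0_norm// -sqrtr_sqr ler_wsqrtr// mxtrace_gram exchange_big /=.
rewrite expr2 mulr_suml; apply: ler_sum => i _; rewrite mulr_suml.
apply: ler_sum => j _; rewrite -real_normK ?num_real// expr2 ler_wpM2l//.
rewrite (bigD1 i)//= (bigD1 j)//= -addrA lerDl addr_ge0 ?sumr_ge0// => k _.
by rewrite sumr_ge0.
Qed.

Lemma posdef_gram (R : realType) (m n : nat) (M : 'M[R]_(m, n)) :
  row_full M -> posdef_mx (M^T *m M).
Proof.
move=> fM; split=> [|x x0]; first by rewrite trmx_mul trmxK.
have Mx0 : M *m x != 0.
  apply: contra x0 => /eqP Mx0.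
  by rewrite -[x]mul1mx -(mulVpmx fM) -mulmxA Mx0 mulmx0.
have -> : (x^T *m (M^T *m M) *m x) 0 0 = \tr ((M *m x)^T *m (M *m x)).
  by rewrite trmx_mul !mulmxA /mxtrace big_ord1.
rewrite lt0r mxtrace_gram_ge0 andbT; apply: contra Mx0.
rewrite mxtrace_gram big_ord1 psumr_eq0 => [/allP h|i _]; last exact: sqr_ge0.
apply/eqP/matrixP => i j; rewrite ord1 [RHS]mxE; apply/eqP.
by have := h i (mem_index_enum i); rewrite sqrf_eq0.
Qed.

Lemma inv_chol_unitmx (R : realType) (n : nat) (G : 'M[R]_n) :
  posdef_mx G -> inv_chol G \in unitmx.
Proof. by move/inv_cholP/mulmx1_unit => []. Qed.

Lemma invmx_posdef (R : realType) (n : nat) (G : 'M[R]_n) :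
  posdef_mx G -> invmx G = inv_chol G *m (inv_chol G)^T.
Proof.
move=> pG; have /mulmx1C CG := inv_cholP pG.
have [_ uG] := mulmx1_unit (etrans (esym (mulmxA _ _ _)) CG).
by rewrite -[LHS]mul1mx -CG -!mulmxA mulmxV// mulmx1.
Qed.

Definition orthonormalize (R : realType) (m n : nat) (M : 'M[R]_(m, n)) :
    'M[R]_(m, n) :=
  M *m inv_chol (M^T *m M).

Lemma orthonormalizeP (R : realType) (m n : nat) (M : 'M[R]_(m, n)) :
  row_full M -> (orthonormalize M)^T *m orthonormalize M = 1%:M.
Proof.
by move/posdef_gram/inv_cholP <-; rewrite /orthonormalize trmx_mul !mulmxA.
Qed.

(** When the derivative of the frame is orthogonal to its span, the Gram matrix
    is stationary, so orthonormalization only multiplies the derivative by a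
    constant matrix. *)
Lemma is_derive_orthonormalize (R : realType) (m n : nat)
    (F : R -> 'M[R]_(m, n)) (t : R) (X : 'M[R]_(m, n)) :
  row_full (F t) -> is_derive t 1 F X -> (F t)^T *m X = 0 ->
  is_derive t 1 (fun s => orthonormalize (F s)) (X *m inv_chol ((F t)^T *m F t)).
Proof.
move=> fF dF FX0.
have dG : is_derive t 1 (fun s => (F s)^T *m F s) 0.
  apply: is_derive_eq (is_derive_mulmx (is_derive_trmx dF) dF) _.
  by rewrite FX0 -[F t]trmxK -trmx_mul FX0 trmx0 addr0.
apply: is_derive_eq (is_derive_mulmx dF (is_derive_inv_chol0 (posdef_gram fF) dG)) _.
by rewrite mulmx0 addr0.
Qed.

Lemma inv_chol1 (R : realType) (n : nat) : inv_chol (1%:M : 'M[R]_n) = 1%:M.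
Proof.
elim: n => [//|n IHn].
suff : inv_chol (1%:M : 'M[R]_(1 + n)) = 1%:M :> 'M[R]_(1 + n) by [].
rewrite inv_cholS scalar_mx_block block_mxKur mul0mx scaler0.
rewrite /schur block_mxKul block_mxKdr block_mxKur trmx0 mul0mx scaler0 subr0 IHn.
by rewrite mxE eqxx sqrtr1 invr1 -!scalar_mx_block.
Qed.

(** * Spans of columns and orthonormal complements *)

Definition span_cols (R : realType) (m n : nat) (M : 'M[R]_(m, n)) :
    {vspace 'cV[R]_m} :=
  <<[seq col i M | i : 'I_n]>>%VS.

Lemma span_cols_mulmx_sub (R : realType) (m n p : nat) (M : 'M[R]_(m, n))
    (C : 'M[R]_(n, p)) : (span_cols (M *m C) <= span_cols M)%VS.
Proof.
apply/span_subvP => _ /mapP[j _ ->].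
have -> : col j (M *m C) = \sum_i C i j *: col i M.
  apply/colP => k; rewrite !mxE summxE; apply: eq_bigr => i _.
  by rewrite !mxE mulrC.
apply: memv_suml => i _; apply: memvZ; apply: memv_span.
by apply: map_f; rewrite mem_enum.
Qed.

Lemma span_cols_mulmx_unit (R : realType) (m n : nat) (M : 'M[R]_(m, n))
    (C : 'M[R]_n) : C \in unitmx -> span_cols (M *m C) = span_cols M.
Proof.
move=> uC; apply/eqP; rewrite eqEsubv span_cols_mulmx_sub /=.
by rewrite -{1}[M](mulmxK uC) span_cols_mulmx_sub.
Qed.

Lemma span_cols_orthonormalize (R : realType) (m n : nat) (M : 'M[R]_(m, n)) :
  row_full M -> span_cols (orthonormalize M) = span_cols M.
Proof. by move=> /posdef_gram/inv_chol_unitmx; exact: span_cols_mulmx_unit. Qed.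

(** The left kernel of U has dimension q; orthonormalize a basis of it. *)
Lemma orthonormal_complement (R : realType) (p q : nat) (U : 'M[R]_(p + q, p)) :
  U^T *m U = 1%:M ->
  exists W : 'M[R]_(p + q, q), W^T *m W = 1%:M /\ U^T *m W = 0.
Proof.
move=> UU.
have rU : \rank U = p.
  apply/eqP; rewrite eqn_leq rank_leq_col -[leqLHS](@mxrank1 R) -UU.
  exact: mxrankM_maxr.
have rK : \rank (kermx U) = q by rewrite mxrank_ker rU addKn.
have [K [KU fK]] : exists K : 'M[R]_(q, p + q), K *m U = 0 /\ row_free K.
  have : exists K : 'M[R]_(\rank (kermx U), p + q), K *m U = 0 /\ row_free K.
    exists (row_base (kermx U)); split; last exact: row_base_free.
    by apply/sub_kermxP; rewrite eq_row_base.
  by rewrite rK.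
exists (orthonormalize K^T); split.
  by apply: orthonormalizeP; rewrite /row_full mxrank_tr.
by rewrite /orthonormalize mulmxA -trmx_mul KU trmx0 mul0mx.
Qed.

Lemma continuous_det (R : realType) (n : nat) (F : R -> 'M[R]_n) (t : R) :
  (forall i j, {for t, continuous (fun s => F s i j)}) ->
  {for t, continuous (fun s => \det (F s))}.
Proof.
move=> cF.
rewrite (_ : (fun s => _) =
  \sum_(sg : 'S_n) (fun s => (-1) ^+ sg * (\prod_i (fun s => F s i (sg i))) s)).
  apply: (big_ind (fun f : R -> R => {for t, continuous f})).
  - exact: cvg_cst.
  - by move=> f g cf cg; exact: cvgD.
  move=> sg _; apply: cvgM; first exact: cvg_cst.
  apply: (big_ind (fun f : R -> R => {for t, continuous f})).
  - exact: cvg_cst.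
  - by move=> f g cf cg; exact: cvgM.
  by move=> i _; exact: cF.
apply/funext => s; rewrite fct_sumE /determinant; apply: eq_bigr => sg _.
by congr (_ * _); rewrite fct_prodE.
Qed.

Lemma near_unitmx (R : realType) (n : nat) (F : R -> 'M[R]_n) (t : R)
    (X : 'M[R]_n) :
  is_derive t 1 F X -> F t \in unitmx -> \forall s \near t, F s \in unitmx.
Proof.
move=> /is_derive_mxP dF; rewrite unitmxE unitfE => Ft.
have cF : {for t, continuous (fun s => \det (F s))}.
  apply: continuous_det => i j.
  by apply/differentiable_continuous/derivable1_diffP; exact: ex_derive.
have : \forall s \near t, \det (F s) != 0.
  exact: (cvgr_neq0 _ cF Ft).
by apply: filterS => s; rewrite unitmxE unitfE.
Qed.

(** * Horizontal lifts of curves of frames *)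

Lemma row_full_mul_unitmx (R : realType) (m n : nat) (S : 'M[R]_(n, m))
    (M : 'M[R]_(m, n)) : S *m M \in unitmx -> row_full M.
Proof.
rewrite -row_full_unit => /eqP rSM.
by rewrite /row_full eqn_leq rank_leq_col -{1}rSM mxrankM_maxr.
Qed.

Lemma orthonormal_entry_le1 (R : realType) (m n : nat) (U : 'M[R]_(m, n)) i j :
  U^T *m U = 1%:M -> `|U i j| <= 1.
Proof.
move=> /matrixP/(_ j j); rewrite !mxE eqxx mulr1n => U1.
rewrite -(ler_pXn2r (_ : (0 < 2)%N)) ?nnegrE// expr1n real_normK ?num_real//.
rewrite -U1 (bigD1 i)//= mxE -expr2 lerDl sumr_ge0// => k _.
by rewrite mxE -expr2 sqr_ge0.
Qed.

(** Pythagoras: the difference is the squared Frobenius norm of U^T M. *)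
Lemma mxtrace_gram_proj_le (R : realType) (m n k : nat) (U : 'M[R]_(m, n))
    (M : 'M[R]_(m, k)) : U^T *m U = 1%:M ->
  \tr ((M - U *m U^T *m M)^T *m (M - U *m U^T *m M)) <= \tr (M^T *m M).
Proof.
move=> UU; have -> : (M - U *m U^T *m M)^T *m (M - U *m U^T *m M) =
    M^T *m M - (U^T *m M)^T *m (U^T *m M).
  rewrite [(M - _)^T]linearB /= !trmx_mul trmxK mulmxBl !mulmxBr !mulmxA.
  rewrite -(mulmxA _ U^T U) UU mulmx1.
  by rewrite subrr subr0.
by rewrite linearB /= gerBl mxtrace_gram_ge0.
Qed.

(** Lifting a curve of orthonormal frames U whose derivative X1 at t is
    orthogonal to the span of U t. The second block of the lift is the
    orthonormalized projection of a constant frame W0 to the complement of U s.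
    The derivative of this projection at t is the X2 below; its columns lie in
    the span of U t, so orthonormalizing does not change it. The derivative of
    the lift is then Q t times an off-diagonal block matrix, hence horizontal. *)
Section HorizontalLift.
Variables (R : realType) (p q : nat) (t : R).
Variables (U : R -> 'M[R]_(p + q, p)) (X1 : 'M[R]_(p + q, p)).
Hypothesis dU : is_derive t 1 U X1.
Hypothesis near_U : \forall s \near t, (U s)^T *m U s = 1%:M.
Hypothesis UX1 : (U t)^T *m X1 = 0.
Variable W0 : 'M[R]_(p + q, q).
Hypothesis WW : W0^T *m W0 = 1%:M.
Hypothesis UW : (U t)^T *m W0 = 0.

Let W s := W0 - U s *m (U s)^T *m W0.
Let Q s := row_mx (U s) (orthonormalize (W s)).
Let X2 := - (U t *m X1^T *m W0).

Let W_t : W t = W0.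
Proof. by rewrite /W -mulmxA UW mulmx0 subr0. Qed.

Let WU : W0^T *m U t = 0.
Proof. by rewrite -[U t]trmxK -trmx_mul UW trmx0. Qed.

Let dW : is_derive t 1 W X2.
Proof.
have dP := is_derive_mulmx (is_derive_mulmx dU (is_derive_trmx dU))
  (is_derive_cst W0 t 1).
apply: is_derive_eq (is_deriveB (is_derive_cst W0 t 1) dP) _.
by rewrite /cst mulmx0 addr0 mulmxDl -mulmxA UW mulmx0 !add0r.
Qed.

Let fullW0 : row_full W0.
Proof. by apply: (@row_full_mul_unitmx _ _ _ W0^T); rewrite WW unitmx1. Qed.

Let dQ : is_derive t 1 Q (row_mx X1 X2).
Proof.
apply: is_derive_row_mx => //.
apply: is_derive_eq (is_derive_orthonormalize _ dW _) _; rewrite W_t//.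
  by rewrite /X2 mulmxN !mulmxA WU !mul0mx oppr0.
by rewrite WW inv_chol1 mulmx1.
Qed.

Let near_Q : \forall s \near t, orthogonal_mx (Q s).
Proof.
have dWW := is_derive_mulmx (is_derive_cst W0^T t 1) dW.
have /(near_unitmx dWW) : cst W0^T t *m W t \in unitmx.
  by rewrite W_t WW unitmx1.
apply: filterS2 near_U => s UU uWW.
have fW : row_full (W s) by apply: row_full_mul_unitmx uWW.
have UWs : (U s)^T *m W s = 0.
  by rewrite /W mulmxBr !mulmxA UU mul1mx subrr.
have UQ : (U s)^T *m orthonormalize (W s) = 0.
  by rewrite /orthonormalize mulmxA UWs mul0mx.
rewrite /orthogonal_mx /Q tr_row_mx mul_col_row UU orthonormalizeP// UQ.
by rewrite -(trmxK (_ *m U s)) trmx_mul trmxK UQ trmx0 -scalar_mx_block.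
Qed.

Let horizontal_X : horizontal (Q t) (row_mx X1 X2).
Proof.
move=> _ [a [b [_ _ ->]]]; rewrite /lk_metric mulmxA /Q tr_row_mx mul_col_row.
have X1U : X1^T *m U t = 0 by rewrite -[LHS]trmxK trmx_mul trmxK UX1 trmx0.
have -> : X2^T *m orthonormalize (W t) = 0.
  rewrite /orthonormalize W_t WW inv_chol1 mulmx1 linearN /= !trmx_mul trmxK.
  by rewrite mulNmx -!mulmxA UW !mulmx0 oppr0.
by rewrite X1U mulmx_block !(mul0mx, mulmx0, add0r, addr0) mxtrace_block !mxtrace0 addr0 mulr0.
Qed.

(** The off-diagonal blocks of (Q t)^T X are opposite transposes of each other
    and have equal norms, which cancels the factor 1 / 2 of the metric. *)
Let lk_norm_X : lk_norm (row_mx X1 X2) = Num.sqrt (\tr (X1^T *m X1)).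
Proof.
congr Num.sqrt; rewrite /lk_metric tr_row_mx mul_col_row mxtrace_block.
suff -> : \tr (X2^T *m X2) = \tr (X1^T *m X1).
  by rewrite -mulr2n -[X in _ * X]mulr_natl mulrA mulVf// mul1r.
have UU := nbhs_singleton near_U.
have /mulmx1C QQ := nbhs_singleton near_Q.
move: QQ; rewrite /Q /orthonormalize W_t WW inv_chol1 mulmx1 tr_row_mx mul_row_col => QQ.
rewrite /X2 [(- _)^T]linearN /= mulNmx mulmxN opprK !trmx_mul trmxK.
rewrite -!mulmxA (mulmxA (U t)^T) UU mul1mx mxtrace_mulC -!mulmxA.
have -> : W0 *m W0^T = 1%:M - U t *m (U t)^T by rewrite -QQ addrC addKr.
by rewrite mxtrace_mulC -!mulmxA mulmxBl mul1mx -mulmxA UX1 mulmx0 subr0.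
Qed.

Lemma horizontal_lift_exists : exists (Q : R -> 'M[R]_(p + q)) X,
  [/\ \forall s \near t, orthogonal_mx (Q s) /\ gr_proj (Q s) = span_cols (U s),
      is_derive t 1 Q X, horizontal (Q t) X
    & lk_norm X = Num.sqrt (\tr (X1^T *m X1))].
Proof.
exists Q, (row_mx X1 X2); split=> //.
apply: filterS near_Q => s oQ; split=> //.
rewrite /gr_proj /span_cols; congr span; apply: eq_map => i.
by rewrite /Q colKl.
Qed.

End HorizontalLift.

(** From a differentiable frame B to an orthonormal frame whose derivative at t
    is orthogonal to its span. Subtracting (s - t) B Y, for the least squares
    solution Y of B' = B Y, makes the derivative orthogonal. The condition that
    some rows f of B t form the identity matrix gives the bound: the factor that
    orthonormalizes B t then consists of rows of an orthonormal frame, so its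
    entries are at most 1. *)
Section OrthonormalFrame.
Variables (R : realType) (p q : nat) (t : R).
Variables (B : R -> 'M[R]_(p + q, p)) (B' : 'M[R]_(p + q, p)).
Variable f : 'I_p -> 'I_(p + q).
Hypothesis dB : is_derive t 1 B B'.
Hypothesis fB : rowsub f (B t) = 1%:M.

Let S : 'M[R]_(p, p + q) := rowsub f 1%:M.

Let SB : S *m B t = 1%:M.
Proof. by rewrite -fB [RHS]rowsubE. Qed.

Let G := (B t)^T *m B t.
Let Y := invmx G *m (B t)^T *m B'.
Let frame s := B s *m (1%:M - (s - t) *: Y).
Let U s := orthonormalize (frame s).

Let frame_t : frame t = B t.
Proof. by rewrite /frame subrr scale0r subr0 mulmx1. Qed.

Let fullB : row_full (B t).
Proof. by apply: (@row_full_mul_unitmx _ _ _ S); rewrite SB unitmx1. Qed.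

Let G_unit : G \in unitmx.
Proof.
have /inv_cholP/mulmx1_unit[+ _] := posdef_gram fullB.
by rewrite unitmx_mul => /andP[].
Qed.

Let dframe : is_derive t 1 frame (B' - B t *m Y).
Proof.
have dc : is_derive t 1 (fun s : R => s - t) 1.
  by apply: is_derive_eq; rewrite subr0.
have dY := is_derive_scalemx dc (is_derive_cst Y t 1).
have dD := is_deriveB (is_derive_cst (1%:M : 'M[R]_p) t 1) dY.
apply: is_derive_eq (is_derive_mulmx dB dD) _.
have -> : (cst 1%:M - (fun s => (s - t) *: cst Y s)) t = 1%:M :> 'M[R]_p.
  by rewrite -[LHS]/(1%:M - (t - t) *: Y) subrr scale0r subr0.
by rewrite /= subrr !scale0r addr0 scale1r sub0r mulmxN mulmx1.
Qed.

Let near_frame : \forall s \near t,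
  row_full (frame s) /\ (1%:M - (s - t) *: Y) \in unitmx.
Proof.
have dSF := is_derive_mulmx (is_derive_cst S t 1) dframe.
have /(near_unitmx dSF) : cst S t *m frame t \in unitmx.
  by rewrite frame_t SB unitmx1.
apply: filterS => s u; split; first exact: row_full_mul_unitmx u.
by move: u; rewrite mulmxA unitmx_mul => /andP[].
Qed.

Let BY_normal : (B t)^T *m (B' - B t *m Y) = 0.
Proof. by rewrite mulmxBr mulmxA /Y !mulmxA -/G mulmxV// mul1mx subrr. Qed.

Let X1 := (B' - B t *m Y) *m inv_chol G.

Let dU : is_derive t 1 U X1.
Proof.
have ff : row_full (frame t) by rewrite frame_t.
apply: is_derive_eq (is_derive_orthonormalize ff dframe _) _; rewrite frame_t//.
Qed.

Let near_U : \forall s \near t,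
  (U s)^T *m U s = 1%:M /\ span_cols (U s) = span_cols (B s).
Proof.
apply: filterS near_frame => s [ff uY]; split; first exact: orthonormalizeP.
by rewrite span_cols_orthonormalize// span_cols_mulmx_unit.
Qed.

Let UX1 : (U t)^T *m X1 = 0.
Proof.
by rewrite /U /orthonormalize frame_t trmx_mul -mulmxA (mulmxA (B t)^T) BY_normal mul0mx mulmx0.
Qed.

Let X1E : X1 = B' *m inv_chol G - U t *m (U t)^T *m (B' *m inv_chol G).
Proof.
rewrite /X1 mulmxBl /Y (invmx_posdef (posdef_gram fullB)).
rewrite /U /orthonormalize frame_t trmx_mul.
by rewrite !mulmxA.
Qed.

Let inv_chol_entry_le1 i j : `|inv_chol G i j| <= 1.
Proof.
have -> : inv_chol G = rowsub f (U t).
  by rewrite rowsubE /U /orthonormalize frame_t mulmxA SB mul1mx.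
rewrite mxE; apply: orthonormal_entry_le1.
by have [] := nbhs_singleton near_U.
Qed.

Lemma orthonormal_frame_exists : exists (U : R -> 'M[R]_(p + q, p)) X,
  [/\ is_derive t 1 U X,
      \forall s \near t, (U s)^T *m U s = 1%:M /\
        span_cols (U s) = span_cols (B s),
      (U t)^T *m X = 0
    & Num.sqrt (\tr (X^T *m X)) <= p%:R * \sum_i \sum_j `|B' i j|].
Proof.
exists U, X1; split=> //.
have [UU _] := nbhs_singleton near_U.
apply: (@le_trans _ _ (Num.sqrt (\tr ((B' *m inv_chol G)^T *m (B' *m inv_chol G))))).
  by rewrite ler_wsqrtr// X1E mxtrace_gram_proj_le.
apply: le_trans (sqrt_mxtrace_gram_le _) _.
rewrite mulr_sumr; apply: ler_sum => i _.
have -> (x : R) : p%:R * x = \sum_(j < p) x by rewrite sumr_const card_ord mulr_natl.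
apply: ler_sum => j _.
rewrite mxE; apply: le_trans (ler_norm_sum _ _ _) _; apply: ler_sum => k _.
by rewrite normrM ler_piMr.
Qed.

End OrthonormalFrame.

Lemma gr_speed_ge0 (R : realType) (p q : nat) (V : R -> grassmann R p q) (t : R) :
  (0 <= gr_speed V t)%E.
Proof. by apply: le_ereal_inf_tmp => _ [X _ <-]; rewrite lee_fin sqrtr_ge0. Qed.

(** The speed is the norm of a horizontal lift, and the lift built from the
    orthonormalized frame has the norm of that frame's derivative. *)
Lemma gr_speed_le_frame (R : realType) (p q : nat) (V : R -> grassmann R p q)
    (t : R) (B : R -> 'M[R]_(p + q, p)) (B' : 'M[R]_(p + q, p))
    (f : 'I_p -> 'I_(p + q)) :
  is_derive t 1 B B' -> rowsub f (B t) = 1%:M ->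
  (\forall s \near t, gr_space (V s) = span_cols (B s)) ->
  (gr_speed V t <= (p%:R * \sum_i \sum_j `|B' i j|)%:E)%E.
Proof.
move=> dB fB VB.
have [U [X [dU nU UX leX]]] := orthonormal_frame_exists dB fB.
have nU1 : \forall s \near t, (U s)^T *m U s = 1%:M.
  by apply: filterS nU => s [].
have [W [WW UW]] := orthonormal_complement (nbhs_singleton nU1).
have [Q [Y [nQ dQ hY nY]]] := horizontal_lift_exists dU nU1 UX WW UW.
apply: ge_ereal_inf; exists (lk_norm Y)%:E; last by rewrite lee_fin nY.
exists Y => //; exists Q; split=> //.
apply: filterS3 nQ nU VB => s [oQ QU] [_ UB] ->.
by rewrite QU UB.
Qed.

(** * Maximal minors *)

(** A factorization of M through its rank shows that the span of its columns has
    at most that dimension. *)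
Lemma row_full_dim_span_cols (R : realType) (m n : nat) (M : 'M[R]_(m, n)) :
  \dim (span_cols M) = n -> row_full M.
Proof.
move=> dM; rewrite /row_full eqn_leq rank_leq_col -{1}dM.
have := dimvS (span_cols_mulmx_sub (col_base M) (row_base M)).
rewrite mulmx_base => /leq_trans; apply.
by apply: leq_trans (dim_span _) _; rewrite size_map size_enum_ord.
Qed.

(** Selections of rows are arbitrary functions: repetitions and changes of order
    only produce zero minors and signs, and the replacement of a row in Cramer's
    rule is then a mere update of the selection. *)
Definition upd_row (p N : nat) (f : {ffun 'I_p -> 'I_N}) (k : 'I_p) (i : 'I_N) :
    {ffun 'I_p -> 'I_N} :=
  [ffun l => if l == k then i else f l].

(** Cramer's rule: expand the minor on the right along its row k, which is row i
    of A, while the cofactors are those of rowsub f A. *)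
Lemma mulmx_adj_rowsub (R : comRingType) (p N : nat) (A : 'M[R]_(N, p))
    (f : {ffun 'I_p -> 'I_N}) i k :
  (A *m \adj (rowsub f A)) i k = \det (rowsub (upd_row f k i) A).
Proof.
rewrite (expand_det_row _ k) mxE; apply: eq_bigr => j _.
rewrite mxE [in RHS]mxE ffunE eqxx; congr (_ * (_ * \det _)).
by apply/matrixP => a b; rewrite !mxE ffunE eq_sym (negPf (neq_lift _ _)).
Qed.

Lemma mulmx_invmx_rowsub (R : fieldType) (p N : nat) (A : 'M[R]_(N, p))
    (f : {ffun 'I_p -> 'I_N}) i k : \det (rowsub f A) != 0 ->
  (A *m invmx (rowsub f A)) i k =
  \det (rowsub (upd_row f k i) A) / \det (rowsub f A).
Proof.
move=> d0; rewrite /invmx unitmxE unitfE d0 -scalemxAr mxE mulmx_adj_rowsub.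
exact: mulrC.
Qed.

Lemma exists_max_minor (R : realType) (p N : nat) (A : 'M[R]_(N, p)) :
  row_full A -> exists f : {ffun 'I_p -> 'I_N}, \det (rowsub f A) != 0 /\
    forall g : {ffun 'I_p -> 'I_N},
      `|\det (rowsub g A)| <= `|\det (rowsub f A)|.
Proof.
move=> fA; pose f0 : {ffun 'I_p -> 'I_N} := fullrankfun fA.
have f0A : \det (rowsub f0 A) != 0.
  by rewrite -unitfE -unitmxE fullrowsub_unit.
pose f := [arg max_(g > f0) `|\det (rowsub g A)|]%O.
have fmax (g : {ffun 'I_p -> 'I_N}) : `|\det (rowsub g A)| <= `|\det (rowsub f A)|.
  by rewrite /f; case: arg_maxP => // h _ hmax; exact: hmax.
exists f; split=> //; rewrite -normr_gt0; apply: lt_le_trans (fmax f0).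
by rewrite normr_gt0.
Qed.

(** * Pencils of matrices *)

Section Pencil.
Variables (R : realType) (p N : nat) (e d : 'I_p -> 'cV[R]_N).

Definition pencil (s : R) : 'M[R]_(N, p) := \matrix_(i, j) (e j + s *: d j) i 0.

Definition pencil_minor (f : {ffun 'I_p -> 'I_N}) : {poly R} :=
  \det (\matrix_(i, j) ((e j (f i) 0)%:P + (d j (f i) 0) *: 'X)).

Lemma horner_pencil_minor f s :
  (pencil_minor f).[s] = \det (rowsub f (pencil s)).
Proof.
rewrite -[LHS]/(horner_eval s _) -det_map_mx; congr (\det _).
apply/matrixP => i j; rewrite !mxE /= /horner_eval hornerD hornerZ hornerC hornerX.
by rewrite mulrC.
Qed.

Lemma size_pencil_minor f : (size (pencil_minor f) <= p.+1)%N.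
Proof.
apply: leq_trans (size_sum _ _ _) _; apply/bigmax_leqP => sg _.
rewrite size_Msign; apply: leq_trans (size_poly_prod_leq _ _) _.
rewrite leq_subLR card_ord addnS ltnS addnn -muln2.
have -> : (p * 2)%N = (\sum_(i < p) 2)%N by rewrite sum_nat_const card_ord.
apply: leq_sum => i _.
rewrite mxE (leq_trans (size_polyD _ _))// geq_max (leq_trans (size_polyC_leq1 _))//=.
by rewrite (leq_trans (size_scale_leq _ _))// size_polyX.
Qed.

(** By Cramer's rule the entries are quotients of minors of the pencil, which are
    polynomials in s. *)
Lemma pencil_frame_derive f t : (pencil_minor f).[t] != 0 ->
  is_derive t 1 (fun s => pencil s *m invmx (rowsub f (pencil s)))
    (\matrix_(i, k)
      (((pencil_minor f).[t] * (pencil_minor (upd_row f k i))^`().[t]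
        - (pencil_minor (upd_row f k i)).[t] * (pencil_minor f)^`().[t])
       / (pencil_minor f).[t] ^+ 2)).
Proof.
move=> f0; apply/is_derive_mxP => i k; rewrite mxE.
set P := pencil_minor f; set Q := pencil_minor _.
have dPV := is_derive_inv f0 (is_derive_poly P t).
have dPQ : is_derive t 1 (fun s => Q.[s] / P.[s])
    ((P.[t] * Q^`().[t] - Q.[t] * P^`().[t]) / P.[t] ^+ 2).
  apply: is_derive_eq (is_deriveM (is_derive_poly Q t) dPV) _.
  by rewrite /GRing.scale /=; field.
apply: near_eq_is_derive dPQ.
have : \forall s \near t, P.[s] != 0.
  exact: (cvgr_neq0 _ (@continuous_horner R P t) f0).
apply: filterS => s Ps; rewrite mulmx_invmx_rowsub -?horner_pencil_minor//.
Qed.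

End Pencil.

(** With f chosen so that its minor P is the largest one at t, any other minor Q
    satisfies 1 / P^2 <= 2 / (P^2 + Q^2), which turns the derivative of Q / P
    into twice the angular speed of (P, Q). *)
Lemma gr_speed_le_minors (R : realType) (p q : nat) (V : R -> grassmann R p q)
    (e d : 'I_p -> 'cV[R]_(p + q)) (t : R) :
  (\forall s \near t, gr_space (V s) = span_cols (pencil e d s)) ->
  exists f : {ffun 'I_p -> 'I_(p + q)},
  [/\ (pencil_minor e d f).[t] != 0
    & (gr_speed V t <= (p%:R * \sum_i \sum_k 2 *
      (`|(pencil_minor e d f).[t] * (pencil_minor e d (upd_row f k i))^`().[t]
       - (pencil_minor e d (upd_row f k i)).[t] * (pencil_minor e d f)^`().[t]|
       / ((pencil_minor e d f).[t] ^+ 2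
          + (pencil_minor e d (upd_row f k i)).[t] ^+ 2)))%:E)%E].
Proof.
move=> VA.
have fA : row_full (pencil e d t).
  by apply: row_full_dim_span_cols; rewrite -(nbhs_singleton VA); exact: gr_dim.
have [f [f0 fmax]] := exists_max_minor fA.
have Pf0 : (pencil_minor e d f).[t] != 0 by rewrite horner_pencil_minor.
exists f; split=> //.
have fB : rowsub f (pencil e d t *m invmx (rowsub f (pencil e d t))) = 1%:M.
  by rewrite -mul_rowsub_mx mulmxV// unitmxE unitfE.
apply: le_trans (gr_speed_le_frame (pencil_frame_derive Pf0) fB _) _.
  have Pf : \forall s \near t, (pencil_minor e d f).[s] != 0.
    exact: (cvgr_neq0 _ (@continuous_horner R _ t) Pf0).
  apply: filterS2 VA Pf => s -> Ps; rewrite span_cols_mulmx_unit//.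
  by rewrite unitmx_inv unitmxE unitfE -horner_pencil_minor.
rewrite lee_fin ler_wpM2l//; apply: ler_sum => i _; apply: ler_sum => k _.
have le1 := fmax (upd_row f k i); rewrite -!horner_pencil_minor in le1.
rewrite mxE normrM mulrCA ler_wpM2l// normfV normrX real_normK ?num_real//.
have P0 : 0 < (pencil_minor e d f).[t] ^+ 2 by rewrite exprn_even_gt0.
have PQ0 : 0 < (pencil_minor e d f).[t] ^+ 2 +
    (pencil_minor e d (upd_row f k i)).[t] ^+ 2 by rewrite ltr_pwDl// sqr_ge0.
rewrite ler_pdivlMr// mulrC ler_pdivrMr// mulr_natl mulr2n lerD2l.
by rewrite -ler_sqrt ?sqr_ge0// !sqrtr_sqr.
Qed.

(** * Lengths of linear curves *)

Theorem theorem3 (R : realType) (m n : nat) (hm : (0 < m)%N) (hn : (0 < n)%N) :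
  exists L : R,
    forall (T : R) (V : R -> grassmann R (2 * m)%N (2 * n)%N),
      0 < T -> linear_curve T V -> (gr_length T V <= L%:E)%E.
Proof.
move: (2 * m)%N (2 * n)%N => p q.
pose F := {ffun 'I_p -> 'I_(p + q)}.
pose c : R := p%:R * \sum_(i < p + q) \sum_(k < p) 2.
exists (c * (#|{: F * F}| * p)%:R * pi) => T V T0 [e [d Ved]].
have VA s : 0 <= s <= T -> gr_space (V s) = span_cols (pencil e d s).
  move=> /Ved ->; congr span; apply: eq_map => i.
  by apply/colP => j; rewrite !mxE.
pose W (gh : F * F) := angular_speed_le
  (size_pencil_minor e d gh.1) (size_pencil_minor e d gh.2).
have [S HS] := choice W.
(* The rows f that maximize the minor depend on t, so the kernels of all pairs
   of minors are collected. *)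
pose s := flatten [seq S gh | gh <- enum {: F * F}].
have sS : (size s <= #|{: F * F}| * p)%N.
  rewrite size_flatten /shape -map_comp sumnE big_map.
  rewrite cardT -sum1_size big_distrl /=; apply: leq_sum => gh _.
  by rewrite mul1n; have [] := HS gh.
have c0 : 0 <= c by rewrite mulr_ge0// sumr_ge0// => i _; rewrite sumr_ge0.
apply: (@le_trans _ _ (c * (size s)%:R * pi)%:E); last first.
  by rewrite lee_fin ler_wpM2r ?pi_ge0// ler_wpM2l// ler_nat.
apply: integral_le_cauchy_kernels => //; first exact: gr_speed_ge0.
move=> t /andP[t0 tT].
have [|f [f0 fle]] := @gr_speed_le_minors R p q V e d t.
  near=> u; apply: VA; apply/andP; split; apply: ltW; near: u.
    exact: lt_nbhsr.
  exact: lt_nbhsl.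
apply: le_trans fle _; rewrite lee_fin /c -mulrA ler_wpM2l// mulr_suml.
apply: ler_sum => i _; rewrite mulr_suml; apply: ler_sum => k _.
rewrite ler_wpM2l// big_flatten big_map big_enum /=.
have [_ /(_ t) le1] := HS (f, upd_row f k i); apply: le_trans (le1 _) _.
  by rewrite gt_eqF// ltr_pwDl ?sqr_ge0// exprn_even_gt0.
rewrite (bigD1 (f, upd_row f k i))//= lerDl sumr_ge0// => gh _.
by rewrite sumr_ge0// => z _; exact: cauchy_kernel_ge0.
Unshelve. all: by end_near. Qed.
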